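(* Let $\mathbb{A}$ be any set of allowable test processes. Consider any path $\omega\in\Omega$ and any interval forecast $I=[\underline{p},\overline{p}]\in\mathcal{I}$ such that $\omega$ is $\mathbb{A}$-random for the stationary forecasting system $\gamma_I$. Then for any recursive selection process $S\colon\mathbb{S}\to\{0,1\}$ such that $\sum_{k=0}^{n}S(\omega_{1:k})\to\infty$: $$\underline{p}\le\liminf_{n\to\infty}\frac{\sum_{k=0}^{n-1}S(\omega_{1:k})\,\omega_{k+1}}{\sum_{k=0}^{n-1}S(\omega_{1:k})}\le\limsup_{n\to\infty}\frac{\sum_{k=0}^{n-1}S(\omega_{1:k})\,\omega_{k+1}}{\sum_{k=0}^{n-1}S(\omega_{1:k})}\le\overline{p}.$$
   Context: Notation: $\mathbb{N}=\{1,2,\dots\}$, $\mathbb{N}_0=\mathbb{N}\cup\{0\}$. Situations are the finite binary sequences $\mathbb{S}=\bigcup_{n\in\mathbb{N}_0}\{0,1\}^n$, with $\square$ the empty sequence; $sx$ is $s$ with $x\in\{0,1\}$ appended. Paths are elements $\omega$ of $\Omega=\{0,1\}^{\mathbb{N}}$, with $n$-th entry $\omega_n$; $\omega_{1:n}\in\mathbb{S}$ consists of the first $n$ entries, $\omega_{1:0}=\square$. $\mathcal{I}$ is the set of non-empty closed subintervals of $[0,1]$. For $f\colon\{0,1\}\to\mathbb{R}$ and $I\in\mathcal{I}$, $\overline{E}_I(f)=\max_{p\in I}[pf(1)+(1-p)f(0)]$. A forecasting system is a map $\varphi\colon\mathbb{S}\to\mathcal{I}$. For $I\in\mathcal{I}$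 (not assumed computable), the stationary forecasting system $\gamma_I$ is given by $\gamma_I(s)=I$ for all $s\in\mathbb{S}$. A selection process is a map $S\colon\mathbb{S}\to\{0,1\}$. A real process is a map $F\colon\mathbb{S}\to\mathbb{R}$, with $\Delta F(s)(x)=F(sx)-F(s)$. A test process is a non-negative real process with $F(\square)=1$. A supermartingale for $\varphi$ is a real process $M$ with $\overline{E}_{\varphi(s)}(\Delta M(s))\le 0$ for all $s\in\mathbb{S}$; a test supermartingale for $\varphi$ is a test process that is a supermartingale for $\varphi$. Computability: ''recursive'' means computable by a Turing machine (countable sets such as $\mathbb{S}$ and $\mathbb{S}\times\mathbb{N}_0$ are identified with $\mathbb{N}_0$ by recursive bijections with recursive inverse). A real process $F$ is computable if there are a recursive family of rationals $r_{s,n}$ and a recursive map $e\colon\mathbb{S}\times\mathbb{N}_0\to\mathbb{N}_0$ such that $n\ge e(s,N)$ implies $|r_{s,n}-F(s)|\le 2^{-N}$. A set of allowable test processes is any countable set $\mathbb{A}$ of test processes that contains all computable (strictly) positive test processes. A path $\omega$ is $\mathbb{A}$-random for $\varphi$ if $\sup_{n\in\mathbb{N}}T(\omega_{1:n})<\infty$ for every $T\in\mathbb{A}$ that is a test supermartingale for $\varphi$. *)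

(* Defs.v *)
From HB Require Import structures.
From mathcomp Require Import all_boot all_order all_algebra.
From mathcomp Require Import all_classical all_reals all_analysis.
Set Implicit Arguments.
Unset Strict Implicit.
Unset Printing Implicit Defensive.
Import Order.TTheory GRing.Theory Num.Theory.
Import numFieldNormedType.Exports.
Local Open Scope classical_set_scope.
Local Open Scope ring_scope.

(* Deterministic multi-tape Turing machines with n input tapes, one output
   tape and finitely many work tapes, all infinite in both directions. *)

Variant move := MoveLeft | Stay | MoveRight.

Definition displacement (m : move) : int :=
  match m with MoveLeft => -1 | Stay => 0 | MoveRight => 1 end.

(* Tape symbols: None is the blank, Some (inl b) the bit b, and Some (inr a) a
   machine-specific auxiliary symbol. *)
Definition symbol (aux : finType) : finType := option (bool + aux).

(* Tape names: inl i is the i-th input tape, inr None the output tape, and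
   inr (Some w) a work tape. *)
Definition tape_name (n : nat) (work : finType) : finType :=
  ('I_n + option work)%type.

(* The transition function maps the current state and the symbols under the
   heads to the next state together with, for each tape, the symbol to write
   and the head move; the machine halts when it returns None. *)
Record turing_machine (n : nat) := TuringMachine {
  tm_state : finType;
  tm_aux : finType;
  tm_work : finType;
  tm_start : tm_state;
  tm_trans : tm_state -> {ffun tape_name n tm_work -> symbol tm_aux} ->
    option (tm_state * (tape_name n tm_work -> symbol tm_aux * move))
}.

(* Cells are numbered relative to the head, which always scans cell 0. *)
Definition tape (aux : finType) := int -> symbol aux.

Definition word_tape (aux : finType) (w : seq bool) : tape aux :=
  fun i => if i is Posz j then nth None [seq Some (inl b) | b <- w] j else None.

Definition write_move (aux : finType) (t : tape aux) (a : symbol aux * move) :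
    tape aux :=
  fun i => let j := i + displacement a.2 in if j == 0 then a.1 else t j.

Section Run.
Variables (n : nat) (M : turing_machine n).

Definition configuration : Type :=
  tm_state M * (tape_name n (tm_work M) -> tape (tm_aux M)).

Definition tm_step (c : configuration) : option configuration :=
  if tm_trans c.1 [ffun t => c.2 t 0] is Some (q, act)
  then Some (q, fun t => write_move (c.2 t) (act t))
  else None.

Definition tm_init (args : 'I_n -> seq bool) : configuration :=
  (tm_start M,
   fun t => word_tape (tm_aux M) (if t is inl i then args i else [::])).

(* M halts on args with exactly w on its output tape, the head of that tape
   scanning the first symbol of w. *)
Definition tm_outputs (args : 'I_n -> seq bool) (w : seq bool) : Prop :=
  exists (m : nat) (c : configuration),
    [/\ iter m (obind tm_step) (Some (tm_init args)) = Some c,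
        tm_step c = None
      & c.2 (inr None) =1 word_tape (tm_aux M) w].

End Run.

Definition situation := seq bool.

(* On tapes, a situation is written as itself and a natural number in unary;
   the components of an element of S x N_0 are given on separate input tapes. *)
Definition unary (n : nat) : seq bool := nseq n true.

Definition recursive_situation (f : situation -> nat) : Prop :=
  exists M : turing_machine 1,
    forall s, tm_outputs M (fun=> s) (unary (f s)).

Definition recursive_situation_nat (f : situation -> nat -> nat) : Prop :=
  exists M : turing_machine 2, forall s n,
    tm_outputs M (fun i => if i == ord0 then s else unary n) (unary (f s n)).

(* A family of rationals is recursive if sign, numerator and denominator can
   be given by recursive maps; the fractions need not be in lowest terms. *)
Definition recursive_rat_family (r : situation -> nat -> rat) : Prop :=
  exists a b sigma : situation -> nat -> nat,
    [/\ recursive_situation_nat a,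
        recursive_situation_nat b,
        recursive_situation_nat sigma
      & forall s n, (0 < b s n)%N /\
          r s n = (-1) ^+ sigma s n * ((a s n)%:R / (b s n)%:R)].

Definition computable_process (R : realType) (F : situation -> R) : Prop :=
  exists (r : situation -> nat -> rat) (e : situation -> nat -> nat),
    [/\ recursive_rat_family r,
        recursive_situation_nat e
      & forall s n N, (e s N <= n)%N -> `|ratr (r s n) - F s| <= 2 ^- N].

(* omega_n, n >= 1, is w n.-1, so that w k is omega_(k+1). *)
Definition binary_path := nat -> bool.

Definition path_prefix (w : binary_path) (n : nat) : situation := mkseq w n.

Record interval_forecast (R : realType) := IntervalForecast {
  lower : R;
  upper : R;
  lower_ge0 : 0 <= lower;
  lower_le_upper : lower <= upper;
  upper_le1 : upper <= 1
}.

(* The supremum of an affine function over a non-empty compact interval is a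
   maximum. *)
Definition upper_expectation (R : realType) (I : interval_forecast R)
    (f : bool -> R) : R :=
  sup [set p * f true + (1 - p) * f false | p in `[lower I, upper I]].

Definition forecasting_system (R : realType) := situation -> interval_forecast R.

Definition stationary (R : realType) (I : interval_forecast R) :
  forecasting_system R := fun=> I.

Definition selection_process := situation -> bool.

Definition recursive_selection (S : selection_process) : Prop :=
  recursive_situation (fun s => nat_of_bool (S s)).

Definition process_difference (R : realType) (F : situation -> R)
    (s : situation) (x : bool) : R :=
  F (rcons s x) - F s.

Definition test_process (R : realType) (F : situation -> R) : Prop :=
  (forall s, 0 <= F s) /\ F [::] = 1.

Definition supermartingale (R : realType) (phi : forecasting_system R)
    (M : situation -> R) : Prop :=
  forall s, upper_expectation (phi s) (process_difference M s) <= 0.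

Definition test_supermartingale (R : realType) (phi : forecasting_system R)
    (M : situation -> R) : Prop :=
  test_process M /\ supermartingale phi M.

Definition allowable (R : realType) (A : set (situation -> R)) : Prop :=
  [/\ countable A,
      (forall T, A T -> test_process T)
    & forall T, computable_process T -> test_process T ->
        (forall s, 0 < T s) -> A T].

Definition random_path (R : realType) (A : set (situation -> R))
    (phi : forecasting_system R) (w : binary_path) : Prop :=
  forall T, A T -> test_supermartingale phi T ->
    (ereal_sup [set (T (path_prefix w n))%:E | n in [set n | (1 <= n)%N]]
      < +oo)%E.

(* Where no situation has been selected yet the quotient is 0 / 0 = 0. *)
Definition selected_frequency (R : realType) (S : selection_process) (w : binary_path)
    (n : nat) : R :=
  (\sum_(0 <= k < n) (S (path_prefix w k))%:R * (w k)%:R) /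
  (\sum_(0 <= k < n) (S (path_prefix w k))%:R).

(* Main.v *)
Require Import Defs.
From HB Require Import structures.
From mathcomp Require Import all_boot all_order all_algebra.
From mathcomp Require Import all_classical all_reals all_analysis.
From mathcomp Require Import zify ring lra.
Set Implicit Arguments.
Unset Strict Implicit.
Unset Printing Implicit Defensive.
Import Order.TTheory GRing.Theory Num.Theory.
Import numFieldNormedType.Exports.
Local Open Scope classical_set_scope.
Local Open Scope ring_scope.

(* Fix a rational c = h/N just above the upper end of the interval and bet the
   fraction 1/N of the capital on a 1, at price c, whenever S selects.  The
   capital is a positive supermartingale, hence bounded along the path, and its
   logarithm is at least (1/N)(H - cK) - (2/N^2)K, with H the number of selected
   ones and K the number of selected entries; so H/K <= c + 3/N eventually.  The
   lower bound is the mirror image.  With N and c rational, the capital is a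
   quotient of products of natural numbers over the selected prefixes, and a
   Turing machine for such a product restarts the machine of S once per prefix. *)

(** * Tapes and runs *)

Section Tapes.
Variable aux : finType.
Implicit Types (t : tape aux) (w : seq bool).

Definition tape_at t (k : int) : tape aux := fun i => t (i + k).

Lemma tape_at0 t : tape_at t 0 = t.
Proof. by apply/funext => i; rewrite /tape_at addr0. Qed.

Lemma write_move_id t k m :
  write_move (tape_at t k) (tape_at t k 0, m) = tape_at t (k + displacement m).
Proof.
apply/funext => i; rewrite /write_move /tape_at /=.
case: eqP => [|_]; last by congr t; lia.
by move=> h; congr t; lia.
Qed.

Lemma write_stay t : write_move t (t 0, Stay) = t.
Proof. by have := write_move_id t 0 Stay; rewrite addr0 tape_at0. Qed.

Lemma word_tape_nat w (j : nat) :
  word_tape aux w j = nth None [seq Some (inl b) | b <- w] j.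
Proof. by []. Qed.

Lemma word_tape_lt w (j : nat) : (j < size w)%N ->
  word_tape aux w j = Some (inl (nth false w j)).
Proof. by move=> h; rewrite word_tape_nat (nth_map false). Qed.

Lemma word_tape_size w : word_tape aux w (size w) = None.
Proof. by rewrite word_tape_nat nth_default ?size_map. Qed.

Lemma word_tape_nil i : word_tape aux [::] i = None.
Proof. by case: i => // j; rewrite word_tape_nat nth_nil. Qed.

Lemma word_tape_nil_at k : tape_at (word_tape aux [::]) k = word_tape aux [::].
Proof. by apply/funext => i; rewrite /tape_at !word_tape_nil. Qed.

(** Unary numbers serve as stacks with their top on the left: a push starts on the blank cell in
    front of the word and ends on the new one. *)
Lemma push_word w b :
  write_move (tape_at (word_tape aux w) (-1)) (Some (inl b), MoveLeft) =
  tape_at (word_tape aux (b :: w)) (-1).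
Proof.
apply/funext => i; rewrite /write_move /tape_at /=.
case: eqP => [->//|ne].
case e: (i - 1) ne => [[|j]|j] // _.
by rewrite (_ : Posz j.+1 - 1 = Posz j); last lia.
Qed.

Lemma pop_word w b :
  write_move (word_tape aux (b :: w)) (None, MoveRight) = word_tape aux w.
Proof.
apply/funext => i; rewrite /write_move /=.
case: eqP => [h|ne]; first by have ->: i = Negz 0 by lia.
case: i ne => [j|[|j]] // ne; first by rewrite (_ : Posz j + 1 = Posz j.+1); last lia.
Qed.

Lemma drop_last_word w b :
  write_move (tape_at (word_tape aux (rcons w b)) (size w)) (None, MoveLeft) =
  tape_at (word_tape aux w) ((size w)%:Z - 1).
Proof.
apply/funext => i; rewrite /write_move /tape_at /=.
case: eqP => [h|ne].
  have ->: i + ((size w)%:Z - 1) = size w by lia.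
  by rewrite word_tape_size.
have ->: i + ((size w)%:Z - 1) = i - 1 + size w by lia.
case e: (_ + _) => [j|] //=.
rewrite map_rcons nth_rcons size_map; case: ltnP => // h.
rewrite nth_default ?size_map //; case: eqP => // jw; exfalso; lia.
Qed.

End Tapes.

Section Reach.
Variables (n : nat) (M : turing_machine n).
Implicit Types c : configuration M.

Definition reach c c' :=
  exists m, iter m (obind (@tm_step n M)) (Some c) = Some c'.

Lemma reach_refl c : reach c c. Proof. by exists 0%N. Qed.

Lemma reach_trans c1 c2 c3 : reach c1 c2 -> reach c2 c3 -> reach c1 c3.
Proof. by move=> [m h] [p k]; exists (p + m)%N; rewrite iterD h. Qed.

Lemma reach_step c1 c2 c3 : tm_step c1 = Some c2 -> reach c2 c3 -> reach c1 c3.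
Proof. by move=> h; apply: reach_trans; exists 1%N; rewrite /= h. Qed.

End Reach.

(* A tape simulated on a tape that still holds the remains of an earlier run.
   Cells carry two marks, telling whether they are the leftmost or the
   rightmost cell visited in the present run, and everything beyond these is
   ignored.  When the head enters a cell for the first time its content is
   ignored too; the flag, which lives in the state, then is [Some] of its marks. *)
Section SimulatedTape.
Variable aux : finType.

Definition cell : finType := (symbol aux * bool * bool)%type.
Definition flag : finType := option (bool * bool)%type.
Implicit Types (T : tape aux) (t : tape cell) (fl : flag).

Definition read_cell fl (x : symbol cell) : cell :=
  match fl, x with
  | Some (l, r), _ => (None, l, r)
  | None, Some (inr c) => c
  | _, _ => (None, true, true)
  end.

(** The mark on the side of the move is erased, because the cell entered next lies further out on
    that side. *)
Definition sim_write fl (x : symbol cell) (a : symbol aux * move) :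
    symbol cell * move :=
  let: (_, l, r) := read_cell fl x in
  (Some (inr (a.1, (if a.2 is MoveLeft then false else l),
                   (if a.2 is MoveRight then false else r))), a.2).

Definition sim_flag fl (x : symbol cell) (m : move) : flag :=
  let: (_, l, r) := read_cell fl x in
  match m with
  | MoveLeft => if l then Some (true, false) else None
  | Stay => None
  | MoveRight => if r then Some (false, true) else None
  end.

(** [l] and [r] are the ends of the visited stretch, relative to the head. Cell 0 is treated apart,
    since the flag may override its content; outside the stretch [t] is arbitrary. *)
Definition represents fl t T := exists l r : int,
  [/\ l <= 0 <= r,
      read_cell fl (t 0) = (T 0, 0 == l, 0 == r),
      (forall i, l <= i <= r -> i != 0 ->
         t i = Some (inr (T i, i == l, i == r)))
    & (forall i, ~~ (l <= i <= r) -> T i = None)].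

(** Nothing is asked of [t]: the flag alone makes it count as blank, so a new run needs no clean-up
    of the previous one. *)
Lemma represents_fresh t : represents (Some (true, true)) t (word_tape aux [::]).
Proof.
exists 0, 0; split=> // [i h /negP[]|i _]; last exact: word_tape_nil.
apply/eqP; lia.
Qed.

Lemma represents_read fl t T : represents fl t T -> (read_cell fl (t 0)).1.1 = T 0.
Proof. by case=> l [r [_ ->]]. Qed.

(** A move past an outer mark enters a cell that is blank in [T], and the new flag supplies this
    blank together with the marks; any other move ends on a cell whose record is valid. *)
Lemma represents_write fl t T a : represents fl t T ->
  represents (sim_flag fl (t 0) a.2) (write_move t (sim_write fl (t 0) a))
    (write_move T a).
Proof.
case=> l [r [/andP[l0 r0] hd ht hT]]; rewrite /sim_flag /sim_write hd.
case: a => a [] /=.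
- exists (if 0 == l then 0 else l + 1), (r + 1); split.
  + by case: eqP; lia.
  + case: eqP => [el|nl] /=; rewrite /write_move /=.
      rewrite hT; last by lia.
      by congr (_, _, _); lia.
    rewrite ht /=; [|lia..].
    by congr (_, _, _); lia.
  + move=> i hi i0; rewrite /write_move /=; case: eqP => ei.
      by congr (Some (inr (_, _, _))); case: eqP hi => ? hi; lia.
    rewrite ht; [|case: eqP hi; lia|lia].
    by congr (Some (inr (_, _, _))); case: eqP hi => ? hi; lia.
  + move=> i hi; rewrite /write_move /=; case: eqP => ei.
      by case: eqP hi; lia.
    by rewrite hT //; case: eqP hi; lia.
- exists l, r; split; rewrite ?l0 ?r0 //.
  + move=> i hi i0; rewrite /write_move /= addr0 (negbTE i0); exact: ht.
  + by move=> i hi; rewrite /write_move /= addr0 hT //; case: eqP => // i0; lia.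
- exists (l - 1), (if 0 == r then 0 else r - 1); split.
  + by case: eqP; lia.
  + case: eqP => [el|nl] /=; rewrite /write_move /=.
      rewrite hT; last by lia.
      by congr (_, _, _); lia.
    rewrite ht /=; [|lia..].
    by congr (_, _, _); lia.
  + move=> i hi i0; rewrite /write_move /=; case: eqP => ei.
      by congr (Some (inr (_, _, _))); case: eqP hi => ? hi; lia.
    rewrite ht; [|case: eqP hi; lia|lia].
    by congr (Some (inr (_, _, _))); case: eqP hi => ? hi; lia.
  + move=> i hi; rewrite /write_move /=; case: eqP => ei.
      by case: eqP hi; lia.
    by rewrite hT //; case: eqP hi; lia.
Qed.

End SimulatedTape.

(** * A machine for products over the selected entries *)

Definition weight (S : selection_process) (f : bool -> nat) (s : situation) :=
  (\prod_(k < size s) if S (take k s) then f (nth false s k) else 1)%N.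

Lemma weight_nil S f : weight S f [::] = 1%N.
Proof. by rewrite /weight big_ord0. Qed.

(** The machine follows this recursion: erasing the last bit leaves on the input tape exactly the
    prefix on which [S] is to be evaluated. *)
Lemma weight_rcons S f s b :
  weight S f (rcons s b) = (weight S f s * if S s then f b else 1)%N.
Proof.
rewrite /weight size_rcons big_ord_recr /= nth_rcons ltnn eqxx.
rewrite -cats1 take_size_cat //; congr (_ * _)%N.
by apply: eq_bigr => i _; rewrite take_cat nth_cat ltn_ord.
Qed.

Section WeightMachine.
Variables (M : turing_machine 1) (f : bool -> nat).

Local Notation sim_name := (tape_name 1 (tm_work M)).
Local Notation sim_cell := (cell (tm_aux M)).
Local Notation sym := (symbol sim_cell).
Local Notation flags := {ffun sim_name -> flag}.
Local Notation counter := 'I_(f true + f false).+1.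

(* Per round, the last bit b is erased from the input, the rest of the input is
   copied to the simulated input tape, M is run on it, and if the result is 1
   the unary number on the output tape is multiplied by f b. *)
Inductive phase :=
  | Init
  | Seek
  | Last
  | Copy of bool & flag
  | Run of bool & tm_state M & flags
  | Mul of bool & counter
  | Ret.

Definition phase_code (p : phase) :
    option (option (option unit)) + (bool * flag) +
    (bool * tm_state M * flags) + (bool * counter) :=
  match p with
  | Init => inl (inl (inl None))
  | Seek => inl (inl (inl (Some None)))
  | Last => inl (inl (inl (Some (Some None))))
  | Ret => inl (inl (inl (Some (Some (Some tt)))))
  | Copy b fl => inl (inl (inr (b, fl)))
  | Run b q fl => inl (inr (b, q, fl))
  | Mul b k => inr (b, k)
  end.

Definition phase_decode x : phase :=
  match x with
  | inl (inl (inl None)) => Init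
  | inl (inl (inl (Some None))) => Seek
  | inl (inl (inl (Some (Some None)))) => Last
  | inl (inl (inl (Some (Some (Some tt))))) => Ret
  | inl (inl (inr (b, fl))) => Copy b fl
  | inl (inr (b, q, fl)) => Run b q fl
  | inr (b, k) => Mul b k
  end.

Lemma phase_codeK : cancel phase_code phase_decode.
Proof. by case. Qed.

HB.instance Definition _ := Finite.copy phase (can_type phase_codeK).

(** [Some t] simulates the tape [t] of [M]; [None] is a scratch tape for the multiplication. *)
Definition weight_work : finType := option sim_name.

Local Notation name := (tape_name 2 weight_work).

Definition sim_input : sim_name := inl ord0.
Definition sim_output : sim_name := inr None.

Local Notation one := (Some (inl true) : sym).

Local Notation act := (sym * move)%type.

(** [Init] writes the empty product 1. [Mul b k] owes [k] ones to the scratch tape and, when none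
    are owed, trades a one of the output for [f b] new ones; [Ret] carries the result back. *)
Definition weight_core (p : phase) (ri ro rw : sym) (rs : sim_name -> sym) :
    option (phase * (act * act * act * (sim_name -> act))) :=
  let same t := (rs t, Stay) in
  match p with
  | Init => Some (Seek, ((ri, Stay), (one, Stay), (rw, Stay), same))
  | Seek =>
      if ri is None then Some (Last, ((ri, MoveLeft), (ro, Stay), (rw, Stay), same))
      else Some (Seek, ((ri, MoveRight), (ro, Stay), (rw, Stay), same))
  | Last =>
      if ri is Some (inl b)
      then Some (Copy b (Some (true, true)),
                 ((None, MoveLeft), (ro, Stay), (rw, Stay), same))
      else None
  | Copy b fl =>
      let x := rs sim_input in
      let sim a t := if t == sim_input then sim_write fl x a else (rs t, Stay) in
      if ri is Some (inl b')
      then Some (Copy b (sim_flag fl x MoveLeft),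
                 ((ri, MoveLeft), (ro, Stay), (rw, Stay),
                  sim (Some (inl b'), MoveLeft)))
      else Some (Run b (tm_start M)
                   [ffun t => if t == sim_input then sim_flag fl x MoveRight
                              else Some (true, true)],
                 ((ri, MoveRight), (ro, Stay), (rw, Stay),
                  sim ((read_cell fl x).1.1, MoveRight)))
  | Run b q fl =>
      let read := [ffun t => (read_cell (fl t) (rs t)).1.1] in
      if tm_trans q read is Some (q', a)
      then Some (Run b q' [ffun t => sim_flag (fl t) (rs t) (a t).2],
                 ((ri, Stay), (ro, Stay), (rw, Stay),
                  fun t => sim_write (fl t) (rs t) (a t)))
      else Some (if read sim_output is Some (inl true) then Mul b ord0 else Seek,
                 ((ri, Stay), (ro, Stay), (rw, Stay), same))
  | Mul b k =>
      if (k : nat) is k'.+1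
      then Some (Mul b (inord k'), ((ri, Stay), (ro, Stay), (one, MoveLeft), same))
      else if ro is None
      then Some (Ret, ((ri, Stay), (ro, Stay), (rw, MoveRight), same))
      else Some (Mul b (inord (f b)),
                 ((ri, Stay), (None, MoveRight), (rw, Stay), same))
  | Ret =>
      if rw is None
      then Some (Seek, ((ri, Stay), (ro, MoveRight), (rw, Stay), same))
      else Some (Ret, ((ri, Stay), (one, MoveLeft), (None, MoveRight), same))
  end.

Definition weight_trans (p : phase) (rd : {ffun name -> sym}) :
    option (phase * (name -> act)) :=
  if weight_core p (rd (inl ord0)) (rd (inr None)) (rd (inr (Some None)))
       (fun t => rd (inr (Some (Some t)))) is Some (q, (ai, ao, aw, as_))
  then Some (q, fun t => match t with
                         | inl i => if i == ord0 then ai else (rd (inl i), Stay)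
                         | inr None => ao
                         | inr (Some None) => aw
                         | inr (Some (Some t)) => as_ t
                         end)
  else None.

Definition weight_machine : turing_machine 2 :=
  {| tm_state := phase; tm_aux := sim_cell; tm_work := weight_work;
     tm_start := Init; tm_trans := weight_trans |}.

(** * Runs of the product machine, phase by phase *)

Local Notation tp := (tape sim_cell).
Local Notation conf := (configuration weight_machine).
Implicit Types (ti to tw : tp) (ts : sim_name -> tp) (s : seq bool) (fls : flags).
Local Notation word := (word_tape sim_cell).
Local Notation unary_tape v := (word (unary v)).

Definition tapes (t2 : tp) ti to tw ts (t : name) : tp :=
  match t with
  | inl i => if i == ord0 then ti else t2
  | inr None => to
  | inr (Some None) => tw
  | inr (Some (Some t)) => ts t
  end.

Lemma weight_transE (t2 : tp) ti to tw ts (p : phase) :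
  weight_trans p [ffun t => tapes t2 ti to tw ts t 0] =
  if weight_core p (ti 0) (to 0) (tw 0) (fun t => ts t 0) is
    Some (q, (ai, ao, aw, as_))
  then Some (q, fun t => match t with
                         | inl i => if i == ord0 then ai else (t2 0, Stay)
                         | inr None => ao
                         | inr (Some None) => aw
                         | inr (Some (Some t)) => as_ t
                         end)
  else None.
Proof.
rewrite /weight_trans !ffunE /=.
have -> : (fun t : sim_name => [ffun t => tapes t2 ti to tw ts t 0] (inr (Some (Some t)))) =
          (fun t => ts t 0).
  by apply/funext => t; rewrite ffunE.
case: weight_core => [[q [[[ai ao] aw] as_]]|//]; congr (Some (_, _)).
by apply/funext => -[i|[[t|]|]] //; rewrite ffunE /=; case: eqP.
Qed.

Lemma weight_step (t2 : tp) ti to tw ts (p q : phase) ai ao aw as_ (c : conf) :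
  weight_core p (ti 0) (to 0) (tw 0) (fun t => ts t 0) =
    Some (q, (ai, ao, aw, as_)) ->
  reach ((q, tapes t2 (write_move ti ai) (write_move to ao) (write_move tw aw)
             (fun t => write_move (ts t) (as_ t))) : conf) c ->
  reach ((p, tapes t2 ti to tw ts) : conf) c.
Proof.
move=> h; apply: reach_step; rewrite /tm_step /= weight_transE h.
congr (Some (_, _)); apply/funext => -[i|[[t|]|]] //=.
case: eqP => // _; exact: write_stay.
Qed.

Lemma write_stay_fun ts : (fun t => write_move (ts t) (ts t 0, Stay)) = ts.
Proof. by apply/funext => t; exact: write_stay. Qed.

(** For empty [s] the head ends on the blank cell -1, where [Last] halts. *)
Lemma reach_seek (t2 : tp) s to tw ts (j : nat) : (j <= size s)%N ->
  @reach 2 weight_machine (Seek, tapes t2 (tape_at (word s) j%:Z) to tw ts)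
    (Last, tapes t2 (tape_at (word s) ((size s)%:Z - 1)) to tw ts).
Proof.
move=> js; have [d] := ubnPeq (size s - j)%N; elim: d j js => [|d IH] j js hd.
  have -> : j = size s by lia.
  apply: weight_step.
    by rewrite /weight_core {1}/tape_at add0r word_tape_size.
  rewrite write_move_id !write_stay write_stay_fun; exact: reach_refl.
apply: weight_step.
  by rewrite /weight_core {1}/tape_at add0r word_tape_lt; last lia.
rewrite write_move_id !write_stay write_stay_fun /= -PoszD addn1.
apply: IH; lia.
Qed.

(** Copying runs from right to left, with [k] bits still to go. At [k = 0] both heads stand on cell
    -1 and step right; with all other simulated tapes flagged as blank, this is the initial
    configuration of [M]. *)
Lemma reach_copy (t2 : tp) s b fl to tw ts (k : nat) : (k <= size s)%N ->
  represents fl (ts sim_input)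
    (tape_at (word_tape (tm_aux M) (drop k s)) (-1)) ->
  exists (fls : flags) ts',
    @reach 2 weight_machine
      (Copy b fl, tapes t2 (tape_at (word s) (k%:Z - 1)) to tw ts)
      (Run b (tm_start M) fls, tapes t2 (word s) to tw ts') /\
    forall t, represents (fls t) (ts' t) ((tm_init M (fun=> s)).2 t).
Proof.
elim: k fl ts => [|k IH] fl ts ks hr.
  rewrite drop0 in hr; do 2!eexists; split.
    apply: weight_step => //.
    rewrite !write_stay sub0r write_move_id addNr tape_at0; exact: reach_refl.
  move=> t; rewrite ffunE /=; case: eqP => [->|ne].
    rewrite (represents_read hr).
    have := represents_write (tape_at (word_tape _ s) (-1) 0, MoveRight) hr.
    by rewrite write_move_id addNr tape_at0.
  rewrite /=; case: t ne => [i|o] ne; last exact: represents_fresh.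
  by rewrite (ord1 i) in ne.
have rd : tape_at (word s) (k.+1%:Z - 1) 0 = Some (inl (nth false s k)).
  by rewrite -(word_tape_lt sim_cell ks) /tape_at; congr word_tape; lia.
set ts1 := fun t => write_move (ts t)
  (if t == sim_input
   then sim_write fl (ts sim_input 0) (Some (inl (nth false s k)), MoveLeft)
   else (ts t 0, Stay)).
have [|fls [ts' [h1 h2]]] := IH (sim_flag fl (ts sim_input 0) MoveLeft) ts1 (ltnW ks).
  rewrite /ts1 eqxx (drop_nth false) // -push_word.
  exact: (represents_write (Some (inl _), MoveLeft) hr).
exists fls, ts'; split=> //; apply: weight_step => [|].
  by rewrite /weight_core rd.
rewrite !write_stay -rd write_move_id.
by have -> : k.+1%:Z - 1 + displacement MoveLeft = k%:Z - 1 by rewrite /=; lia.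
Qed.

Lemma reach_sim_step (t2 : tp) ti b q q' fls to tw ts T T' :
  (forall t, represents (fls t) (ts t) (T t)) ->
  tm_step ((q, T) : configuration M) = Some (q', T') ->
  exists (fls' : flags) ts',
    @reach 2 weight_machine
      (Run b q fls, tapes t2 ti to tw ts) (Run b q' fls', tapes t2 ti to tw ts') /\
    forall t, represents (fls' t) (ts' t) (T' t).
Proof.
move=> hr; rewrite /tm_step /=.
case e: tm_trans => [[q1 a]|] //= [<- <-].
do 2!eexists; split.
  apply: weight_step => [|].
    rewrite /weight_core (_ : finfun _ = [ffun t => T t 0]) ?e //.
    by apply/ffunP => t; rewrite !ffunE (represents_read (hr t)).
  rewrite !write_stay; exact: reach_refl.
by move=> t; rewrite ffunE; exact: represents_write.
Qed.

Lemma reach_sim (t2 : tp) ti b q fls to tw ts T m (c : configuration M) :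
  (forall t, represents (fls t) (ts t) (T t)) ->
  iter m (obind (@tm_step 1 M)) (Some (q, T)) = Some c ->
  exists (fls' : flags) ts',
    @reach 2 weight_machine
      (Run b q fls, tapes t2 ti to tw ts) (Run b c.1 fls', tapes t2 ti to tw ts') /\
    forall t, represents (fls' t) (ts' t) (c.2 t).
Proof.
move=> hr; elim: m c => [|m IH] c /=.
  by case=> <-; exists fls, ts; split=> //; exact: reach_refl.
case e: (iter m _ _) => [[q1 T1]|] //= hc; case: c hc => q2 T2 hc.
have [fl1 [ts1 [h1 r1]]] := IH _ e.
have [fl2 [ts2 [h2 r2]]] := reach_sim_step t2 ti b to tw r1 hc.
by exists fl2, ts2; split=> //; exact: reach_trans h1 h2.
Qed.

Lemma reach_push (t2 : tp) ti b to ts (k u : nat) : (k <= f true + f false)%N ->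
  @reach 2 weight_machine
    (Mul b (inord k), tapes t2 ti to (tape_at (unary_tape u) (-1)) ts)
    (Mul b ord0, tapes t2 ti to (tape_at (unary_tape (k + u)) (-1)) ts).
Proof.
elim: k u => [|k IH] u hk.
  have -> : inord 0 = ord0 :> counter by apply/val_inj; rewrite /= inordK.
  exact: reach_refl.
apply: weight_step => [|]; first by rewrite /weight_core inordK.
rewrite !write_stay write_stay_fun push_word addSnnS.
exact: (IH u.+1 (ltnW hk)).
Qed.

(** Each of the [v] ones left on the output tape is worth [f b] ones on the scratch tape. *)
Lemma reach_mul (t2 : tp) ti b ts (v u : nat) :
  @reach 2 weight_machine
    (Mul b ord0, tapes t2 ti (unary_tape v) (tape_at (unary_tape u) (-1)) ts)
    (Ret, tapes t2 ti (word [::]) (unary_tape (f b * v + u)) ts).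
Proof.
elim: v u => [|v IH] u.
  apply: weight_step => //; rewrite muln0 !write_stay write_stay_fun.
  rewrite write_move_id addNr tape_at0; exact: reach_refl.
apply: weight_step => //; rewrite !write_stay write_stay_fun pop_word.
apply: reach_trans; first by apply: reach_push; case: (b); lia.
by rewrite (_ : f b * v.+1 + u = f b * v + (f b + u))%N; [exact: IH|lia].
Qed.

Lemma reach_ret (t2 : tp) ti ts (v u : nat) :
  @reach 2 weight_machine
    (Ret, tapes t2 ti (tape_at (unary_tape u) (-1)) (unary_tape v) ts)
    (Seek, tapes t2 ti (unary_tape (v + u)) (word [::]) ts).
Proof.
elim: v u => [|v IH] u.
  apply: weight_step => //; rewrite !write_stay write_stay_fun.
  rewrite write_move_id addNr tape_at0; exact: reach_refl.
apply: weight_step => //; rewrite !write_stay write_stay_fun pop_word.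
rewrite push_word addSnnS; exact: (IH u.+1).
Qed.

Variable S : selection_process.
Hypothesis MS : forall s, tm_outputs M (fun=> s) (unary (S s)).

(** [ts] is arbitrary because it holds the remains of earlier rounds, which [represents_fresh]
    hides. *)
Lemma reach_round (t2 : tp) s b (v : nat) ts : exists ts',
  @reach 2 weight_machine
    (Seek, tapes t2 (word (rcons s b)) (unary_tape v) (word [::]) ts)
    (Seek, tapes t2 (word s) (unary_tape ((if S s then f b else 1) * v))
       (word [::]) ts').
Proof.
have [|fl1 [ts1 [h1 r1]]] := reach_copy t2 b (unary_tape v) (word [::])
  (fl := Some (true, true)) (ts := ts) (leqnn (size s)).
  by rewrite drop_size word_tape_nil_at; exact: represents_fresh.
have [m [c [hm hc hout]]] := MS s.
have [fl2 [ts2 [h2 r2]]] := reach_sim t2 (word s) b (unary_tape v) (word [::]) r1 hm.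
exists ts2; rewrite -{1}[word (rcons s b)]tape_at0.
apply: reach_trans; first exact: (@reach_seek t2 (rcons s b) _ _ ts 0).
have -> : (size (rcons s b))%:Z - 1 = size s by rewrite size_rcons; lia.
apply: weight_step => [|].
  by rewrite /weight_core {1}/tape_at add0r word_tape_lt ?size_rcons //.
rewrite !write_stay write_stay_fun drop_last_word nth_rcons ltnn eqxx.
apply: (reach_trans h1); apply: (reach_trans h2).
(* [M] has halted with its output head on the first cell of [unary (S s)], so the one symbol read
   there decides whether to multiply. *)
move: hc; rewrite /tm_step; case e: tm_trans => [[q a]|] //= _.
apply: weight_step => [|].
  rewrite /weight_core (_ : finfun _ = [ffun t => c.2 t 0]).
    by rewrite e ffunE hout.
  by apply/ffunP => t; rewrite !ffunE (represents_read (r2 t)).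
rewrite !write_stay write_stay_fun.
case: (S s); last by rewrite mul1n; exact: reach_refl.
(* A blank tape looks the same from every cell, so it also is the number 0 with the head one cell in
   front of it. *)
have blank := word_tape_nil_at sim_cell (-1).
rewrite -{1}blank.
apply: reach_trans; first exact: (@reach_mul t2 _ b ts2 v 0).
rewrite -{1}blank addn0.
by have := @reach_ret t2 (word s) ts2 (f b * v) 0; rewrite addn0.
Qed.

Lemma reach_halt (t2 : tp) s (v : nat) ts : exists c : conf,
  [/\ @reach 2 weight_machine
        (Seek, tapes t2 (word s) (unary_tape v) (word [::]) ts) c,
      tm_step c = None & c.2 (inr None) = unary_tape (weight S f s * v)].
Proof.
elim/last_ind: s v ts => [|s b IH] v ts.
  eexists; split.
  - rewrite -{1}[word [::]]tape_at0; exact: (@reach_seek t2 [::] _ _ ts 0).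
  - by rewrite /tm_step /= weight_transE.
  - by rewrite weight_nil mul1n.
have [ts' h] := reach_round t2 s b v ts.
have [c [h1 h2 h3]] := IH ((if S s then f b else 1) * v)%N ts'.
by exists c; split=> //; [exact: reach_trans h1|rewrite weight_rcons -mulnA].
Qed.

Lemma weight_machine_outputs args :
  tm_outputs weight_machine args (unary (weight S f (args ord0))).
Proof.
have [c [h hc ho]] := reach_halt (word (args ord_max)) (args ord0) 1 (fun=> word [::]).
suff [m hm] : reach (tm_init weight_machine args) c.
  by exists m, c; split=> // i; rewrite ho muln1.
have -> : tm_init weight_machine args =
    (Init, tapes (word (args ord_max)) (word (args ord0)) (word [::]) (word [::])
             (fun=> word [::])).
  congr (_, _); apply/funext => -[i|[[t|]|]] //=.
  case: eqP => [->//|/eqP ne]; congr (word (args _)); apply/val_inj => /=.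
  by case: i ne => [[|[|]]].
apply: weight_step => //; rewrite !write_stay.
have -> : write_move (word [::]) (one, Stay) = unary_tape 1; last exact: h.
apply/funext => i; rewrite /write_move addr0; case: eqP => [->//|ne].
by rewrite word_tape_nil; case: i ne => [[|j]|j] //= _; rewrite nth_nil.
Qed.

End WeightMachine.

Lemma recursive_weight S f : recursive_selection S ->
  recursive_situation_nat (fun s _ => weight S f s).
Proof.
by case=> M MS; exists (weight_machine M f) => s n; exact: weight_machine_outputs.
Qed.

(** Zero is the empty word in unary. It serves as sign exponent and as modulus of convergence of the
    capital. *)
Lemma recursive_zero : recursive_situation_nat (fun _ _ => 0%N).
Proof.
exists {| tm_state := unit; tm_aux := void; tm_work := void; tm_start := tt;
          tm_trans := fun _ _ => None |} => s n.
by exists 0%N; eexists; split.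
Qed.

(** * Betting on the selected entries *)

Lemma weight_gt0 S f s : (forall b, 0 < f b)%N -> (0 < weight S f s)%N.
Proof. by move=> f0; apply: prodn_gt0 => i; case: ifP. Qed.

Section Betting.
Variables (R : realType) (S : selection_process) (f : bool -> nat) (D : nat).
Hypotheses (f_gt0 : forall b, (0 < f b)%N) (D_gt0 : (0 < D)%N).

(** The denominator is [D] to the number of selected entries, so each selected bit [b] multiplies
    the capital by [f b / D]. *)
Definition capital (s : situation) : R :=
  (weight S f s)%:R / (weight S (fun=> D) s)%:R.

Lemma capital_nil : capital [::] = 1.
Proof. by rewrite /capital !weight_nil divr1. Qed.

Lemma capital_rcons s b :
  capital (rcons s b) = capital s * (if S s then (f b)%:R / D%:R else 1).
Proof.
rewrite /capital !weight_rcons; case: (S s); last by rewrite !muln1 mulr1.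
by rewrite !natrM mulf_div.
Qed.

Lemma capital_gt0 s : 0 < capital s.
Proof. by rewrite divr_gt0 // ltr0n weight_gt0. Qed.

Lemma capital_test_process : test_process capital.
Proof. by split=> [s|]; [exact/ltW/capital_gt0|exact: capital_nil]. Qed.

(** The values are rational, so the approximations can be constant and exact. *)
Lemma computable_capital : recursive_selection S -> computable_process capital.
Proof.
move=> hS; exists (fun s _ => (weight S f s)%:R / (weight S (fun=> D) s)%:R).
exists (fun _ _ => 0%N); split; last first.
- by move=> s n N _; rewrite fmorph_div /= !ratr_nat subrr normr0 invr_ge0 exprn_ge0.
- exact: recursive_zero.
- exists (fun s _ => weight S f s), (fun s _ => weight S (fun=> D) s),
    (fun _ _ => 0%N); split; [exact: recursive_weight..|exact: recursive_zero|].
  by move=> s n; rewrite weight_gt0 // expr0 mul1r.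
Qed.

Lemma capital_supermartingale (I : interval_forecast R) :
  (forall p : R, lower I <= p <= upper I ->
     p * (f true)%:R + (1 - p) * (f false)%:R <= D%:R) ->
  supermartingale (stationary I) capital.
Proof.
move=> hf s; rewrite /upper_expectation /stationary /process_difference.
apply: ge_sup.
  eexists; exists (lower I); last by [].
  by rewrite /= in_itv /= lexx lower_le_upper.
move=> _ [p /= + <-]; rewrite in_itv /= => hp; rewrite !capital_rcons.
case: (S s); last by rewrite mulr1 subrr !mulr0 addr0.
have D0 : 0 < D%:R :> R by rewrite ltr0n.
(* The expected gain is the capital times the expected factor minus 1. *)
rewrite (_ : _ + _ = capital s * ((p * (f true)%:R + (1 - p) * (f false)%:R) / D%:R - 1)).
  by rewrite pmulr_rle0 ?capital_gt0 // subr_le0 ler_pdivrMr // mul1r; exact: hf.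
by field; rewrite gt_eqF.
Qed.

Lemma ln_capital (w : binary_path) n :
  ln (capital (path_prefix w n)) =
  \sum_(0 <= k < n) (S (path_prefix w k))%:R * ln ((f (w k))%:R / D%:R).
Proof.
elim: n => [|n IH]; first by rewrite big_geq // capital_nil ln1.
rewrite big_nat_recr //= -IH /path_prefix mkseqS capital_rcons.
have f0 : 0 < (f (w n))%:R / D%:R :> R by rewrite divr_gt0 ?ltr0n.
rewrite lnM ?posrE ?capital_gt0 //; last by case: ifP.
by case: (S _); rewrite ?mul1r ?mul0r ?ln1.
Qed.

End Betting.

(** Since [ln (1 - z) <= - z] at [z = y / (1 + y)], one gets [ln (1 + y) >= y / (1 + y)], which
    exceeds [y - 2 y^2] by [y^2 (1 + 2 y) / (1 + y) >= 0]. *)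
Lemma ln1D_ge (R : realType) (y : R) : - 2^-1 <= y -> y - 2 * y ^+ 2 <= ln (1 + y).
Proof.
move=> hy; have y1 : 0 < 1 + y by lra.
have : ln (1 + - (y / (1 + y))) <= - (y / (1 + y)).
  by apply: le_ln1Dx; rewrite ltrN2 ltr_pdivrMr // mul1r; lra.
have -> : 1 + - (y / (1 + y)) = (1 + y)^-1 by field; rewrite gt_eqF.
rewrite lnV ?posrE // lerN2; apply: le_trans.
rewrite ler_pdivlMr //; nra.
Qed.

(** The sum is the logarithm of [capital], which lies in [A] because it is computable and
    positive. *)
Lemma random_path_ln_bounded (R : realType) (A : set (situation -> R))
    (w : binary_path) (I : interval_forecast R) (S : selection_process)
    (f : bool -> nat) (D : nat) :
  allowable A -> random_path A (stationary I) w -> recursive_selection S ->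
  (forall b, 0 < f b)%N -> (0 < D)%N ->
  (forall p : R, lower I <= p <= upper I ->
     p * (f true)%:R + (1 - p) * (f false)%:R <= D%:R) ->
  exists C : R, forall n,
    \sum_(0 <= k < n.+1) (S (path_prefix w k))%:R * ln ((f (w k))%:R / D%:R) <= C.
Proof.
move=> [_ _ hA] hw hS f0 D0 hf.
have capA : A (capital R S f D).
  apply: hA; [exact: computable_capital|exact: capital_test_process|].
  exact: capital_gt0.
have := hw _ capA (conj (capital_test_process R S f0 D0) (capital_supermartingale S f0 D0 hf)).
set X := (X in ereal_sup X) => hX.
have ub n : ((capital R S f D (path_prefix w n.+1))%:E <= ereal_sup X)%E.
  by apply: ereal_sup_ubound; exists n.+1.
(* Randomness bounds the supremum from above; from below it dominates a real value. *)
have : ereal_sup X \is a fin_num.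
  by rewrite fin_real // hX andbT; apply: lt_le_trans (ub 0%N); rewrite ltNyr.
move=> /fineK X_fin; exists (ln (fine (ereal_sup X))) => n.
have c0 := capital_gt0 R S f0 D0 (path_prefix w n.+1).
rewrite -ln_capital // ler_ln ?posrE // -?lee_fin ?X_fin //.
by rewrite -lte_fin X_fin; exact: lt_le_trans (ub n).
Qed.

(** * From bounded capital to selected frequencies *)

Section Frequency.
Variables (R : realType) (A : set (situation -> R)) (w : binary_path).
Variables (I : interval_forecast R) (S : selection_process).
Hypotheses (hA : allowable A) (hw : random_path A (stationary I) w).
Hypothesis hS : recursive_selection S.
Hypothesis hSinf :
  (\sum_(0 <= k < n.+1) (S (path_prefix w k))%:R : R) @[n --> \oo] --> +oo.

(** [sg = 1] bets on ones at a price [h / N] no less than [upper I], and [sg = -1] bets against them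
    at a price no more than [lower I]. With [D = N^2] the factor is [1 + sg (b - h / N) / N]. Of the
    bound [3 / N], the quadratic term of the logarithm costs [2 / N] and the constant [C] at most
    [1 / N] once [K >= C N^2]. *)
Lemma frequency_bound (sg : R) (N h : nat) (f : bool -> nat) :
  sg ^+ 2 = 1 -> (1 < N)%N -> (h <= N)%N -> (forall b, 0 < f b)%N ->
  (forall b : bool, (f b)%:R = N%:R ^+ 2 + sg * (N%:R * b%:R - h%:R) :> R) ->
  (forall p, lower I <= p <= upper I -> sg * (N%:R * p - h%:R) <= 0) ->
  \forall n \near \oo, sg * (selected_frequency R S w n.+1 - h%:R / N%:R) <= 3 / N%:R.
Proof.
move=> sg1 N1 hN f0 fE hp.
have N0 : 0 < N%:R :> R by rewrite ltr0n; exact: ltnW.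
have [] := @random_path_ln_bounded R A w I S f (N ^ 2) hA hw hS f0.
- by rewrite expn_gt0 (ltnW N1).
- by move=> p /hp; rewrite !fE natrX /=; nra.
move=> C hC; pose x : R := N%:R^-1; pose c : R := h%:R / N%:R.
have x0 : 0 < x by rewrite invr_gt0.
have lnE (b : bool) : sg * x * (b%:R - c) - 2 * x ^+ 2 <= ln ((f b)%:R / (N ^ 2)%:R).
  have -> : (f b)%:R / (N ^ 2)%:R = 1 + sg * x * (b%:R - c).
    by rewrite fE natrX /x /c; field; rewrite gt_eqF.
  have x2 : x <= 2^-1 by rewrite lef_pV2 ?posrE // ler_nat.
  have bc : (b%:R - c) ^+ 2 <= 1.
    have c0 : 0 <= c by rewrite divr_ge0.
    have c1 : c <= 1 by rewrite ler_pdivrMr // mul1r ler_nat.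
    by case: b => /=; nra.
  apply: le_trans (ln1D_ge _); last first.
    (* As [x <= 1 / 2], this gives the lower bound -1/2 that [ln1D_ge] requires. *)
    have : (sg * x * (b%:R - c)) ^+ 2 <= x ^+ 2.
      by rewrite !exprMn sg1 mul1r ler_piMr // sqr_ge0.
    nra.
  by rewrite lerD2l lerN2 ler_pM2l // !exprMn sg1 mul1r ler_piMr // sqr_ge0.
(* The 1 keeps the frequency away from 0 / 0; [C / x^2] makes [C <= x^2 K]. *)
move/cvgryPge: hSinf => /(_ (Num.max 1 (C / x ^+ 2))).
move=> big; apply: filterS big => n; rewrite ge_max => /andP[K1 KC].
rewrite /selected_frequency; set K := \sum_(_ <= _ < _) _ in K1 KC *.
set H := \sum_(_ <= _ < _) _ in KC *.
have K0 : 0 < K by exact: lt_le_trans K1.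
have := hC n; rewrite ler_pdivrMr ?exprn_gt0 // in KC => {}hC.
have : sg * x * (H - c * K) - 2 * x ^+ 2 * K <= C.
  apply: le_trans hC; rewrite /H /K mulr_sumr mulr_sumr -sumrB mulr_sumr -sumrB.
  apply: ler_sum => k _.
  have := lnE (w k); case: (S _) => /=; last by rewrite !(mul0r, mulr0, subr0).
  by rewrite !mul1r !mulr1.
move=> hHK; rewrite -/x -(ler_pM2r K0) -(ler_pM2r x0).
have -> : sg * (H / K - c) * K * x = sg * x * (H - c * K).
  by field; rewrite gt_eqF.
nra.
Qed.

End Frequency.

(** The limit superior is an infimum over tails, so one tail, from [m.+1] on, suffices for each
    [e]. *)
Lemma limn_esup_le (R : realType) (u : nat -> R) (l : R) :
  (forall e, 0 < e -> \forall n \near \oo, u n.+1 <= l + e) ->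
  (limn_esup (EFin \o u) <= l%:E)%E.
Proof.
move=> hu; apply/lee_addgt0Pr => e e0; have [m _ hm] := hu e e0.
rewrite /limn_esup limf_esupE.
apply: (@le_trans _ _ (ereal_sup ((EFin \o u) @` [set n | (m.+1 <= n)%N]))).
  apply: ereal_inf_lbound; exists [set n | (m.+1 <= n)%N] => //.
  by exists m.+1.
apply: ge_ereal_sup => _ [[|n] //= mn <-].
by rewrite -EFinD lee_fin; exact: hm.
Qed.

(** Of [4 / N], the betting argument uses [3 / N] and rounding an end of the interval to a multiple
    of [1 / N] uses the rest. *)
Lemma exists_fine_grid (R : realType) (e : R) : 0 < e ->
  exists N : nat, (1 < N)%N /\ 4 / N%:R <= e.
Proof.
move=> e0; exists (Num.truncn (4 / e)).+2; split=> //.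
rewrite ler_pdivrMr ?ltr0n // mulrC -ler_pdivrMr //.
have /andP[_ /ltW h] := truncn_itv (divr_ge0 (ler0n R 4) (ltW e0)).
by apply: le_trans h _; rewrite ler_nat.
Qed.

Theorem corollary28 (R : realType) (A : set (situation -> R))
    (hA : allowable A) (w : binary_path) (I : interval_forecast R)
    (hw : random_path A (stationary I) w)
    (S : selection_process) (hS : recursive_selection S)
    (hSinf : (\sum_(0 <= k < n.+1) (S (path_prefix w k))%:R : R) @[n --> \oo]
               --> +oo) :
  ((lower I)%:E <= limn_einf (fun n => (selected_frequency R S w n)%:E))%E /\
  (limn_einf (fun n => (selected_frequency R S w n)%:E)
     <= limn_esup (fun n => (selected_frequency R S w n)%:E))%E /\
  (limn_esup (fun n => (selected_frequency R S w n)%:E) <= (upper I)%:E)%E.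
Proof.
have l0 := lower_ge0 I; have lu := lower_le_upper I; have u1 := upper_le1 I.
split; [|split; first exact: limn_einf_sup].
(* The limit inferior is minus the limit superior of the negated frequencies. *)
- rewrite leeNr -EFinN.
  have -> : (\- (fun n => (selected_frequency R S w n)%:E))%E =
      EFin \o (fun n => - selected_frequency R S w n) by [].
  apply: limn_esup_le => e e0; have [N [N1 Ne]] := exists_fine_grid e0.
  have N0 : 0 < N%:R :> R by rewrite ltr0n; exact: ltnW.
  have /andP[hl hh] : ((Num.truncn (lower I * N%:R))%:R <= lower I * N%:R
      < (Num.truncn (lower I * N%:R)).+1%:R).
    by apply: truncn_itv; rewrite mulr_ge0 // ltW.
  (* Rounding down puts the price [h / N] at most at [lower I], by less than [1 / N]. *)
  set h := Num.truncn _ in hl hh.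
  have hN : (h <= N)%N.
    rewrite -(ler_nat R); apply: le_trans hl _; by rewrite ler_piMl ?(ltW N0) ?(le_trans lu u1).
  (* This is [N^2 - (N b - h)], ordered so that truncated subtraction is exact. *)
  have f0 b : (0 < N ^ 2 + h - N * nat_of_bool b)%N by case: b; nia.
  have := @frequency_bound R A w I S hA hw hS hSinf (-1) N h _ _ N1 hN f0.
  case.
  + by rewrite sqrrN expr1n.
  + move=> b; rewrite natrB; last by case: b; nia.
    by rewrite natrD natrX natrM; ring.
  + by move=> p /andP[lp _]; nra.
  move=> m _ hm; exists m => // n /hm; rewrite mulN1r => hn.
  have : lower I - N%:R^-1 <= h%:R / N%:R.
    by rewrite ler_pdivlMr // mulrBl mulVf ?gt_eqF //; move: hh; rewrite -natr1; lra.
  lra.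
- apply: limn_esup_le => e e0; have [N [N1 Ne]] := exists_fine_grid e0.
  have N0 : 0 < N%:R :> R by rewrite ltr0n; exact: ltnW.
  have /andP[hl hh] : ((Num.truncn (upper I * N%:R))%:R <= upper I * N%:R
      < (Num.truncn (upper I * N%:R)).+1%:R).
    by apply: truncn_itv; rewrite mulr_ge0 ?(ltW N0) ?(le_trans l0 lu).
  (* Rounding up puts the price at least at [upper I]; the cap keeps it at most 1 and is harmless
     because [upper I <= 1]. *)
  set h := minn (Num.truncn (upper I * N%:R)).+1 N.
  have hN : (h <= N)%N by exact: geq_minr.
  have hu : upper I * N%:R <= h%:R.
    by rewrite /h natr_min le_min (ltW hh) ler_piMl ?(ltW N0).
  have hu1 : h%:R <= upper I * N%:R + 1.
    apply: (@le_trans _ _ (Num.truncn (upper I * N%:R)).+1%:R).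
      by rewrite ler_nat geq_minl.
    by rewrite -natr1 lerD2r.
  have f0 b : (0 < N ^ 2 + N * nat_of_bool b - h)%N by case: b; nia.
  have := @frequency_bound R A w I S hA hw hS hSinf 1 N h _ _ N1 hN f0.
  case.
  + by rewrite expr1n.
  + move=> b; rewrite natrB; last by case: b; nia.
    by rewrite natrD natrX natrM; ring.
  + by move=> p /andP[_ pu]; nra.
  move=> m _ hm; exists m => // n /hm; rewrite mul1r => hn.
  have : h%:R / N%:R <= upper I + N%:R^-1.
    by rewrite ler_pdivrMr // mulrDl mulVf ?gt_eqF //.
  lra.
Qed.
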